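(* Let $q>1$, let $(V,E,\mu)$ be a weighted graph with vertex weight $\sigma$ as in the context, and let $o\in V$. If $$\int_1^\infty\Bigl(\sup_{x\in V}p_\sigma(t,o,x)\Bigr)^{q-1}dt<\infty,$$ then there exists $a_0>0$ such that, for every $a\in(0,a_0]$, the Cauchy problem $$\partial_tu-\Delta_\sigma u=u^q\ \ (t>0,\ x\in V),\qquad u(0,x)=a\mathbf 1_{\{o\}}(x)\ \ (x\in V),$$ admits a positive global classical solution.
   Context: Let $(V,E)$ be an infinite, connected, locally finite graph with at most one edge between two distinct vertices and no loops. Let $\mu:V\times V\to[0,\infty)$ be symmetric with $\mu_{xy}>0$ if $x\sim y$ and $\mu_{xy}=0$ otherwise; put $\mu(x)=\sum_{y\sim x}\mu_{xy}$. Fix $\sigma:V\to(0,\infty)$ and set $\nu(x)=\sigma(x)\mu(x)$. The operator is $$\Delta_\sigma f(x)=\frac1{\nu(x)}\sum_{y\sim x}\mu_{xy}(f(y)-f(x)).$$ Standing assumption of the paper: the graph carries an edge-length function $\rho:E\to(0,\infty)$ (symmetric) that is $\nu$-adapted, i.e. $\sum_{y\sim x}\mu_{xy}\rho(x,y)^2\le\nu(x)$ for all $x$, and whose path metric $d_\rho(x,y)=\inf\sum_i\rho(x_{i-1},x_i)$ (infimum over paths from $x$ to $y$) is proper, i.e. all closed balls of $d_\rho$ are finite. For finite connected $D\subset V$, the Dirichlet operator $\Delta_{\sigma,D}$ is obtained by extending functions on $D$ by zero outside $D$ and applying $\Delta_\sigma$ on $D$; $p_{\sigma,D}(t,x,y)$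 is its heat kernel with respect to $\nu$, i.e. $e^{t\Delta_{\sigma,D}}f(x)=\sum_{y\in D}p_{\sigma,D}(t,x,y)f(y)\nu(y)$. The minimal heat kernel $p_\sigma(t,x,y)$ is the monotone limit of $p_{\sigma,D_j}(t,x,y)$ along exhaustions of $V$ by finite connected sets $D_j$. A positive global classical solution of the Cauchy problem with datum $u_0$ is a function $u:[0,\infty)\times V\to[0,\infty)$ with $u(\cdot,x)\in C([0,\infty))\cap C^1((0,\infty))$ for every $x\in V$, satisfying the equation pointwise for $t>0$, $u(0,\cdot)=u_0$, and $u(t,x)>0$ for all $t>0$, $x\in V$. *)

(* Defs.v *)
From HB Require Import structures.
From mathcomp Require Import all_boot all_order all_algebra.
From mathcomp Require Import all_classical all_reals all_analysis.
Set Implicit Arguments.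
Unset Strict Implicit.
Unset Printing Implicit Defensive.
Import Order.TTheory GRing.Theory Num.Theory numFieldNormedType.Exports.
Local Open Scope classical_set_scope.
Local Open Scope ring_scope.

Definition neighbours (V : choiceType) (adj : rel V) (x : V) : set V :=
  [set y | adj x y].

(* Paths are encoded as in [path.v]: a path from x to y is a sequence p with
   [path adj x p] and [last x p = y]; it visits the vertices x :: p. *)
Definition connected_in (V : choiceType) (adj : rel V) (D : set V) :=
  forall x y, D x -> D y ->
    exists p : seq V,
      [/\ path adj x p, last x p = y & forall z, z \in p -> D z].

Record weighted_graph (R : realType) (V : choiceType) := WeightedGraph {
  adj : rel V;
  mu : V -> V -> R;
  adj_sym : symmetric adj;
  adj_irr : irreflexive adj;
  graph_infinite : infinite_set [set: V];
  graph_connected : connected_in adj [set: V];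
  graph_locally_finite : forall x, finite_set (neighbours adj x);
  mu_sym : forall x y, mu x y = mu y x;
  mu_gt0 : forall x y, adj x y -> 0 < mu x y;
  mu_eq0 : forall x y, ~~ adj x y -> mu x y = 0 }.

Section HeatKernel.
Variables (R : realType) (V : choiceType) (G : weighted_graph R V).
Variable sigma : V -> R.

Definition vertex_weight (x : V) : R :=
  \sum_(y \in neighbours (adj G) x) mu G x y.

Definition nu (x : V) : R := sigma x * vertex_weight x.

Definition laplacian (f : V -> R) (x : V) : R :=
  (nu x)^-1 * \sum_(y \in neighbours (adj G) x) (mu G x y * (f y - f x)).

(* Functions on D are represented by functions on V vanishing outside D. *)
Definition zero_outside (D : set V) (f : V -> R) : V -> R :=
  patch (fun=> 0) D f.

Definition dirichlet_laplacian (D : set V) (f : V -> R) : V -> R :=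
  zero_outside D (laplacian (zero_outside D f)).

(* The exponential series of the operator t Delta_D, applied to f and evaluated
   at x; it converges whenever D is finite. *)
Definition dirichlet_semigroup (D : set V) (t : R) (f : V -> R) (x : V) : R :=
  limn (series (fun n =>
    exp_coeff t n * iter n (dirichlet_laplacian D) (zero_outside D f) x)).

(* The kernel of the semigroup with respect to nu: taking f to be the indicator
   of y in D, the identity
     e^(t Delta_D) f x = \sum_(z in D) p_D(t, x, z) * f z * nu z
   reads e^(t Delta_D) f x = p_D(t, x, y) * nu y. *)
Definition dirichlet_heat_kernel (D : set V) (t : R) (x y : V) : R :=
  dirichlet_semigroup D t \1_[set y] x / nu y.

Definition exhaustion (D : nat -> set V) :=
  [/\ forall j, [/\ finite_set (D j), D j !=set0 & connected_in (adj G) (D j)],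
      forall j, D j `<=` D j.+1
    & \bigcup_j D j = [set: V]].

(* The common limit of the Dirichlet heat kernels along all exhaustions. It
   exists for t >= 0, since they are nonnegative, nondecreasing in D, and
   bounded by 1 / nu y; the default value 0 of [xget] is then irrelevant. *)
Definition minimal_heat_kernel (t : R) (x y : V) : R :=
  xget 0 [set l : R | forall D, exhaustion D ->
    dirichlet_heat_kernel (D j) t x y @[j --> \oo] --> l].

Definition edge_length (rho : V -> V -> R) :=
  forall x y, adj G x y -> 0 < rho x y /\ rho x y = rho y x.

Definition adapted (rho : V -> V -> R) :=
  forall x, \sum_(y \in neighbours (adj G) x) (mu G x y * rho x y ^+ 2) <= nu x.

Definition path_length (rho : V -> V -> R) (x : V) (p : seq V) : R :=
  \sum_(r <- pairmap rho x p) r.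

Definition path_metric (rho : V -> V -> R) (x y : V) : R :=
  inf [set path_length rho x p |
        p in [set p : seq V | path (adj G) x p /\ last x p = y]].

Definition proper_metric (d : V -> V -> R) :=
  forall x r, finite_set [set y | d x y <= r].

(* Time-dependent functions are total in t; only their values for t >= 0 are
   constrained. *)
Definition positive_global_classical_solution (q : R) (u0 : V -> R)
    (u : R -> V -> R) :=
  [/\ forall t x, 0 <= t -> 0 <= u t x,
      forall x, {within `[0, +oo[, continuous (u^~ x)} /\
        (forall t, 0 < t -> derivable (u^~ x) t 1) /\
        {in `]0, +oo[, continuous (derive1 (u^~ x))},
      forall t x, 0 < t -> derive1 (u^~ x) t - laplacian (u t) x = u t x `^ q,
      forall x, u 0 x = u0 x
    & forall t x, 0 < t -> 0 < u t x].

End HeatKernel.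

(* Main.v *)
Require Import Defs.
From HB Require Import structures.
From mathcomp Require Import all_boot all_order all_algebra.
From mathcomp Require Import finmap.
From mathcomp Require Import all_classical all_reals all_analysis.
From mathcomp Require Import measurable_realfun.
From mathcomp Require Import ring lra.
Set Implicit Arguments.
Unset Strict Implicit.
Unset Printing Implicit Defensive.
Import Order.TTheory GRing.Theory Num.Theory numFieldNormedType.Exports.
Local Open Scope classical_set_scope.
Local Open Scope ring_scope.

(** Small data give global solutions because a heat flow that decays fast
enough can be multiplied by a bounded factor of time so as to absorb the
nonlinearity. If v is the heat flow started at the indicator of o, then
[w = a * A(t) * v] satisfies
    [w' - Delta w = a * A'(t) * v],
and this dominates [w ^ q = (a * A) ^ (q - 1) * v ^ (q - 1) * a * A * v] as
soon as A' is at least a ^ (q - 1) * A ^ q * (sup v) ^ (q - 1). Since v is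
nu(o) times the heat kernel issued from o, the hypothesis says that
(sup v) ^ (q - 1) has a finite integral over [1, +oo[, while v <= 1 before
that time. For small a the choice
A' = 2 ^ q * a ^ (q - 1) * (sup v) ^ (q - 1) keeps A between 1 and 2. The
problem then has a supersolution bounded by 2a.

To produce a solution below it, write the equation at one vertex x as the
scalar equation [u' = forcing(u) - outrate(x) * u], where [forcing] collects
the flow from the finitely many neighbours and the term u ^ q. The Duhamel
formula turns it into a fixed point problem for a monotone map. Its Picard
iterates started at 0 are nondecreasing, stay below every supersolution, and
converge by dominated convergence to a solution of the integral equation, which
is smooth enough because each [forcing] is a finite sum of continuous
functions. Positivity spreads from o along edges: a zero at a positive time
would be a minimum of u(., x), at which the derivative, being the flow from the
neighbours, could not be positive.

Only Dirichlet flows of finite sets enter. The n-th Picard iterate vanishes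
outside the ball of radius n around o, so it only has to be compared with the
supersolution built from the Dirichlet heat flow of that finite ball
([picard_bounded_by_supersolution]). On a finite set the supremum is a maximum
of continuous functions, hence A is continuously differentiable, and the bound
2a is independent of the ball. Dirichlet kernels are symmetric because the
Laplacian is symmetric for nu ([heat_kernel_sym]). By their differential
equation and the minimum principle on finite sets ([weak_minimum_principle])
they are nonnegative, bounded and increasing in the domain, whence they all lie
below the minimal heat kernel ([heat_kernel_le_minimal]). *)

(** * Scalar linear equations and the Duhamel formula *)

Section Scalar.
Context {R : realType}.
Notation leb := (@lebesgue_measure R).
Implicit Types (f g h w : R -> R) (d c s t T : R).

Lemma continuous_mul f g : continuous f -> continuous g ->
  continuous (fun t => f t * g t).
Proof. by move=> cf cg t; exact: (continuousM (cf t) (cg t)). Qed.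

Lemma continuous_add f g : continuous f -> continuous g ->
  continuous (fun t => f t + g t).
Proof. by move=> cf cg t; exact: (continuousD (cf t) (cg t)). Qed.

(** At l = 0 the map x ^ r is not differentiable, and it jumps to the value 1
    on the negative side; nonnegativity of f excludes that side. *)
Lemma cvg_powR_ge0 (I : Type) (F : set_system I) (FF : Filter F)
    (f : I -> R) (l r : R) : 0 < r -> (forall i, 0 <= f i) -> 0 <= l ->
  f i @[i --> F] --> l -> f i `^ r @[i --> F] --> l `^ r.
Proof.
move=> r0 f0 l0 fl; have [l_eq0|lN0] := eqVneq l 0; last first.
  have l_gt0 : 0 < l by rewrite lt_def lN0.
  have cp : {for l, continuous (fun x : R => x `^ r)}.
    apply: differentiable_continuous; apply/derivable1_diffP.
    by apply: derivable_powR; rewrite in_itv/= l_gt0.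
  exact: (cvg_comp _ _ fl cp).
rewrite l_eq0 powR0 ?gt_eqF//.
apply/cvgrPdist_lt => e e0; near=> i.
rewrite sub0r normrN ger0_norm ?powR_ge0//.
rewrite -[ltRHS](@powRr1 _ e) ?(ltW e0)// -(mulVf (lt0r_neq0 r0)) powRrM.
rewrite gt0_ltr_powR ?nnegrE ?f0 ?powR_ge0//.
near: i; have /cvgrPdist_lt /(_ (e `^ r^-1)) := fl.
rewrite powR_gt0// => /(_ isT); apply: filterS => i.
by rewrite l_eq0 sub0r normrN ger0_norm.
Unshelve. all: by end_near. Qed.

Lemma continuous_integrable_itv h (a b : R) : continuous h ->
  leb.-integrable `[a, b] (EFin \o h).
Proof.
move=> ch; apply: continuous_compact_integrable; first exact: segment_compact.
exact: continuous_subspaceT.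
Qed.

(** Cutting h off at 0 replaces the integral from 0 by one from a negative
    point, so that continuity at t <= 0 is also a statement about an interior
    point of an interval. *)
Lemma continuous_integral_from0 h :
  (forall T, leb.-integrable `[0, T] (EFin \o h)) ->
  continuous (fun t : R => \int[leb]_(s in `[0, t]) h s).
Proof.
move=> ih t; pose b := `|t| + 1; pose h0 := h \_ `[0, +oo[.
have b0 : 0 < b by rewrite ltr_wpDl.
have eqint u : \int[leb]_(s in `[0, u]) h s = \int[leb]_(s in `[- b, u]) h0 s.
  rewrite /h0 -Rintegral_mkcondr; congr (Rintegral _ _ _).
  apply/seteqP; split=> s /=; rewrite !in_itv/=.
    by move=> /andP[s0 ->]; rewrite s0 andbT; split => //; lra.
  by move=> [/andP[_ ->] ]; rewrite !andbT.
rewrite (_ : (fun u => _) =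
    (fun u : R => \int[leb]_(s in `[- b, u]) h0 s)); last exact/funext.
have ih0 : leb.-integrable `[- b, b] (EFin \o h0).
  rewrite /h0 -restrict_EFin; apply/integrable_restrict => //=.
  rewrite (_ : _ `&` _ = `[0, b]%classic); first exact: ih.
  apply/seteqP; split=> s /=; rewrite !in_itv/=.
    by move=> [/andP[_ ->]]; rewrite andbT => ->.
  by move=> /andP[s0 ->]; rewrite s0 andbT; split => //; lra.
have bb : - b <= b by lra.
have := parameterized_integral_continuous bb ih0.
move=> /continuous_within_itvP [|]; first by lra.
move=> + _ _; apply.
by rewrite in_itv/= -ltr_norml /b ltrDl.
Qed.

(** Only the past of t is compared, so t may be the right end of the time
    interval; this is why the conclusion is an inequality. *)
Lemma derive_left_min_le0 f t df : 0 < t -> is_derive t 1 f df ->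
  (forall s, 0 <= s <= t -> f t <= f s) -> df <= 0.
Proof.
move=> t0 dft tmin; rewrite -(@derive_val _ _ _ t 1 f df dft).
have dt : derivable f t 1 by exact: ex_derive.
rewrite ['D_1 f t]cvg_at_leftE; last exact: dt.
apply: limr_le.
  rewrite -(cvg_at_leftE (fun h : R => h^-1 *: ((f \o shift t) _ - f t)))//.
  apply: cvg_trans dt; apply: cvg_app.
  move=> A [e egt0 Ae]; exists e => // x xe xgt0.
  by apply: Ae => //; exact/ltr0_neq0.
near=> h; apply: mulr_le0_ge0.
  by rewrite invr_le0; apply: ltW; near: h; exists 1 => /=.
rewrite subr_ge0 [_%:A]mulr1 /=; apply: tmin.
apply/andP; split; last by rewrite gerDr; near: h; exact: nbhs_left_le.
rewrite -lerBlDr sub0r; near: h; apply: nbhs_left_ge; rewrite oppr_lt0.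
exact: t0.
Unshelve. all: by end_near. Qed.

(** Variation of constants for y' = g - d * y, y 0 = c. For t < 0 the integral
    is over an empty interval, which leaves the exponential expR (- d * t) * c:
    the function is continuous on the whole line, and continuity on [0, +oo[
    needs no separate treatment of the left endpoint. *)
Definition duhamel (d c : R) (g : R -> R) (t : R) : R :=
  expR (- (d * t)) * (c + \int[leb]_(s in `[0, t]) (expR (d * s) * g s)).

Lemma duhamel0 d c g : duhamel d c g 0 = c.
Proof.
by rewrite /duhamel mulr0 oppr0 expR0 mul1r set_itv1 Rintegral_set1 addr0.
Qed.

Lemma duhamel00 d t : duhamel d 0 (fun=> 0) t = 0.
Proof.
rewrite /duhamel add0r.
rewrite (_ : (fun s => _) = cst 0); last by apply/funext => s; rewrite mulr0.
by rewrite Rintegral_cst// mul0r mulr0.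
Qed.

Lemma continuous_expRM (d : R) : continuous (fun s => expR (d * s)).
Proof.
move=> s; apply: (@continuous_comp _ _ _ ( *%R d) expR).
  exact: mulrl_continuous.
exact: continuous_expR.
Qed.

Lemma integrable_expRM d g T : leb.-integrable `[0, T] (EFin \o g) ->
  leb.-integrable `[0, T] (EFin \o (fun s => expR (d * s) * g s)).
Proof.
move=> ig.
have bde : [bounded expR (d * s) | s in `[0, T]].
  have := continuous_compact (continuous_subspaceT (@continuous_expRM d))
    (@segment_compact _ 0 T).
  move=> /compact_bounded[M [_ mrt]].
  exists M; split; first exact: num_real.
  by move=> x Mx s s0; apply: (mrt x Mx); exists s.
apply: (@integrableMr _ (measurableTypeR R) R leb `[0, T]%classic _
  (fun s => expR (d * s)) (EFin \o g)) => //.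
apply: measurable_funTS; apply: continuous_measurable_fun.
exact: continuous_expRM.
Qed.

Lemma duhamel_continuous d c g :
  (forall T, leb.-integrable `[0, T] (EFin \o g)) ->
  continuous (duhamel d c g).
Proof.
move=> ig t.
have ce : {for t, continuous (fun s : R => expR (- (d * s)))}.
  rewrite (_ : (fun s => _) = (fun s => expR ((- d) * s))).
    exact: continuous_expRM.
  by apply/funext => s; rewrite mulNr.
have ci : {for t, continuous (fun u : R =>
    c + \int[leb]_(s in `[0, u]) (expR (d * s) * g s))}.
  apply: continuousD; first exact: cst_continuous.
  by apply: continuous_integral_from0 => T; exact: integrable_expRM.
exact: (continuousM ce ci).
Qed.

Lemma duhamel_derive d c g t : continuous g -> 0 < t ->
  is_derive t 1 (duhamel d c g) (g t - d * duhamel d c g t).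
Proof.
move=> cg t0.
have ch : continuous (fun s : R => expR (d * s) * g s).
  exact: (continuous_mul (@continuous_expRM d) cg).
have [|dF F'] := @continuous_FTC1_closed _ (fun s => expR (d * s) * g s)
    0 t (t + 1) (ltr_pwDr ltr01 (lexx t)) (continuous_integrable_itv _ _ ch) t0.
  exact: ch.
have {dF F'} dF : is_derive t 1 (fun u : R => \int[leb]_(s in `[0, u])
    (expR (d * s) * g s)) (expR (d * t) * g t).
  by rewrite -F' derive1E; exact/derivableP.
rewrite /duhamel.
apply: is_derive_eq.
have EF : expR (- (d * t)) * expR (d * t) = 1 by rewrite -expRD addNr expR0.
rewrite -![_ *: _]/(_ * _) mulr1 -[in RHS](mul1r (g t)) -[in RHS]EF.
by ring.
Qed.

Lemma duhamel_ge d c g t : (forall s, 0 <= s -> 0 <= g s) ->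
  expR (- (d * t)) * c <= duhamel d c g t.
Proof.
move=> g0; rewrite ler_wpM2l ?expR_ge0// lerDl Rintegral_ge0// => s.
by rewrite /= in_itv/= => /andP[s0 _]; rewrite mulr_ge0 ?expR_ge0 ?g0.
Qed.

Lemma duhamel_le d c g1 g2 t : continuous g1 -> continuous g2 ->
  (forall s, g1 s <= g2 s) -> duhamel d c g1 t <= duhamel d c g2 t.
Proof.
move=> c1 c2 g12; rewrite ler_wpM2l ?expR_ge0// lerD2l.
apply: le_Rintegral => //.
- exact/integrable_expRM/continuous_integrable_itv.
- exact/integrable_expRM/continuous_integrable_itv.
- by move=> s _; rewrite ler_wpM2l ?expR_ge0.
Qed.

Lemma eq_duhamel d c g1 g2 t : (forall s, 0 <= s -> g1 s = g2 s) ->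
  duhamel d c g1 t = duhamel d c g2 t.
Proof.
move=> g12; rewrite /duhamel; congr (_ * (_ + _)).
apply: eq_Rintegral => s; rewrite inE/= in_itv/= => /andP[s0 _].
by rewrite g12.
Qed.

(** The difference w - duhamel d c g multiplied by the integrating factor
    expR (d * s) has a nonnegative derivative. *)
Lemma duhamel_le_supersolution d c g w : continuous g -> continuous w ->
  (forall t, 0 < t -> exists2 dw, is_derive t 1 w dw & g t - d * w t <= dw) ->
  c <= w 0 -> forall t, 0 <= t -> duhamel d c g t <= w t.
Proof.
move=> cg cw dw cw0 t t0.
pose z s := expR (d * s) * (w s - duhamel d c g s).
have cz : continuous z.
  apply: (continuous_mul (@continuous_expRM d) _) => s.
  apply: continuousB; first exact: cw.
  by apply: duhamel_continuous => T; exact: continuous_integrable_itv.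
have dz s : 0 < s -> exists2 e, is_derive s 1 z e & 0 <= e.
  move=> s0; have [e de le] := dw s s0.
  have dD := duhamel_derive d c cg s0.
  exists (expR (d * s) * (e + d * w s - g s)); last first.
    by rewrite mulr_ge0 ?expR_ge0//; lra.
  rewrite /z; apply: is_derive_eq.
  rewrite /= -![_ *: _]/(_ * _) ?mulr1; ring.
have : z 0 <= z t.
  apply: (@ger0_derive1_le_cc _ z 0 t) => //.
  - by move=> x; rewrite in_itv/= => /andP[x0 _]; have [] := dz x x0.
  - move=> x; rewrite in_itv/= => /andP[x0 _]; have [e de e0] := dz x x0.
    by rewrite derive1E derive_val.
  - exact: continuous_subspaceT.
  - by rewrite in_itv/= lexx.
  - by rewrite in_itv/= t0 lexx.
have : 0 <= z 0 by rewrite /z duhamel0 mulr0 expR0 mul1r subr_ge0.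
move=> /le_trans /[apply].
by rewrite /z pmulr_rge0 ?expR_gt0// subr_ge0.
Qed.

(** Dominated convergence on [0, t]. The limit g is only measurable and bounded;
    its integrability is part of the conclusion because it is what makes
    duhamel d c g continuous. *)
Lemma duhamel_cvg d c (g_ : nat -> R -> R) g B :
  (forall n, continuous (g_ n)) ->
  (forall s, 0 <= s -> g_ n s @[n --> \oo] --> g s) ->
  (forall n s, 0 <= s -> `|g_ n s| <= B) ->
  (forall T, leb.-integrable `[0, T] (EFin \o g)) /\
  (forall t, 0 <= t -> duhamel d c (g_ n) t @[n --> \oo] --> duhamel d c g t).
Proof.
move=> cg gg gB.
have mg T : measurable_fun `[0, T] g.
  apply: (@measurable_fun_cvg _ _ _ _ g_) => [n|s].
    by apply: measurable_funTS; exact: continuous_measurable_fun.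
  by rewrite /= in_itv/= => /andP[s0 _]; exact: gg.
have Bg s : 0 <= s -> `|g s| <= B.
  move=> s0; have gn : `|g_ n s| @[n --> \oo] --> `|g s|.
    by apply: cvg_norm; exact: gg.
  rewrite -(cvg_lim (@Rhausdorff R) gn); apply: limr_le; first exact/cvgP/gn.
  by apply: nearW => n; exact: gB.
have ig T : leb.-integrable `[0, T] (EFin \o g).
  apply: (@measurable_bounded_integrable _ (measurableTypeR R) R leb) => //.
    rewrite [ltLHS]lebesgue_measure_itv/=.
    by case: ifPn => // _; rewrite -EFinB ltry.
    exact: mg.
  exists B; split; first exact: num_real.
  move=> M BM s /=; rewrite in_itv/= => /andP[s0 _].
  exact: le_trans (Bg _ s0) (ltW BM).
split => // t t0.
apply: cvgM; first exact: cvg_cst.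
apply: cvgD; first exact: cvg_cst.
pose M := expR (`|d| * t) * B.
have ie := integrable_expRM d (ig t).
have leM s x : 0 <= s <= t -> `|x| <= B -> `|expR (d * s) * x| <= M.
  move=> /andP[s0 st] xB; rewrite normrM ger0_norm ?expR_ge0//.
  apply: ler_pM; rewrite ?expR_ge0// ler_expR.
  by rewrite (le_trans (ler_norm _))// normrM (ger0_norm s0) ler_wpM2l.
have [] := @dominated_convergence _ _ R leb `[0, t] (measurable_itv _)
  (fun n s => (expR (d * s) * g_ n s)%:E) (fun s => (expR (d * s) * g s)%:E)
  (cst M%:E).
- move=> n; apply/measurable_EFinP; apply: measurable_funTS.
  apply: continuous_measurable_fun.
  exact: (continuous_mul (@continuous_expRM d) (cg n)).
- by case/integrableP : ie.
- apply: aeW => s /=; rewrite in_itv/= => /andP[s0 _].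
  apply: cvg_EFin; first exact: nearW.
  by apply: cvgM; [exact: cvg_cst|exact: gg].
- apply: (@continuous_integrable_itv (cst M)); exact: cst_continuous.
- apply: aeW => s n /=; rewrite in_itv/= => st.
  by rewrite lee_fin leM// gB//; case/andP: st.
move=> _ _ H.
have fin : (\int[leb]_(x in `[0%R, t]) (expR (d * x) * g x)%:E)%E \is a fin_num.
  exact: integrable_fin_num.
by move: H; rewrite -(fineK fin) => /fine_cvg.
Qed.

End Scalar.

(** Immediate from the integral of a nonnegative function being the supremum
    over the simple functions below it, so it applies to functions that may
    fail to be measurable: here, the supremum over the vertices of the minimal
    heat kernel. *)
Lemma le_ge0_integral d (T : measurableType d) (R : realType)
    (mu : {measure set T -> \bar R}) (f1 f2 : T -> \bar R) (D : set T) :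
  (forall x, D x -> (0 <= f1 x)%E) -> (forall x, D x -> (f1 x <= f2 x)%E) ->
  (\int[mu]_(x in D) f1 x <= \int[mu]_(x in D) f2 x)%E.
Proof.
move=> f10 f12; rewrite !(integral_mkcond D).
have h12 x : ((f1 \_ D) x <= (f2 \_ D) x)%E by apply: lee_restrict.
have h10 x : (0 <= (f1 \_ D) x)%E by apply: erestrict_ge0.
rewrite !ge0_integralTE//; last by move=> x; exact: le_trans (h12 x).
apply: ereal_sup_le => _ [h /= hf <-].
exists h => //= x.
exact: le_trans (hf x) (h12 x).
Qed.

(** * The Laplacian of a weighted graph and its minimum principle *)

Lemma exists_seq_min d (T : eqType) (O : orderType d) (h : T -> O)
    (s : seq T) x0 :
  x0 \in s -> exists2 i, i \in s & forall x, x \in s -> (h i <= h x)%O.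
Proof.
elim: s x0 => // a [_ x0 _|b s IHs x0 _].
  by exists a => [|x]; rewrite ?mem_seq1// => /eqP ->.
have [i is_ imin] := IHs b (mem_head _ _).
have [ai|ia] := leP (h a) (h i).
  exists a => [|x]; first exact: mem_head.
  rewrite in_cons => /predU1P[->//|/imin]; exact: le_trans.
exists i => [|x]; first by rewrite in_cons is_ orbT.
by rewrite in_cons => /predU1P[->|/imin//]; exact: ltW.
Qed.

Section Graph.
Context {R : realType} {V : choiceType}.
Variables (G : weighted_graph R V) (sigma : V -> R).
Hypothesis sigma_gt0 : forall x, 0 < sigma x.
Local Notation nu := (nu G sigma).
Local Notation laplacian := (laplacian G sigma).
Implicit Types (f g : V -> R) (x y z : V) (D : set V).

Definition nbrs x : seq V := fset_set (neighbours (adj G) x).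

Lemma mem_nbrs x y : (y \in nbrs x) = adj G x y.
Proof.
rewrite /nbrs in_fset_set; last exact: graph_locally_finite.
by apply/idP/idP; rewrite inE.
Qed.

Lemma mu_ge0 x y : 0 <= mu G x y.
Proof. by have [/mu_gt0/ltW//|/mu_eq0->//] := boolP (adj G x y). Qed.

(** A vertex of an infinite connected graph is not alone. This makes nu
    positive, so that the inverse of nu in the Laplacian is a true inverse. *)
Lemma exists_neighbour x : exists y, adj G x y.
Proof.
have [y _ yx] : exists2 y, [set: V] y & y <> x.
  apply: contrapT => H; apply: (graph_infinite G).
  apply: (@sub_finite_set _ _ [set x]); last exact: finite_set1.
  by move=> y _; apply: contrapT => yx; apply: H; exists y.
have [[|z p] [/= + + _]] := @graph_connected _ _ G x y I I.
  by move=> _ /esym.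
by move=> /andP[xz _] _; exists z.
Qed.

Lemma vertex_weight_gt0 x : 0 < vertex_weight G x.
Proof.
have [y xy] := exists_neighbour x.
rewrite /vertex_weight fsbig_finite; last exact: graph_locally_finite.
rewrite -/(nbrs x) (big_rem y) ?mem_nbrs//=.
by rewrite ltr_pwDl ?mu_gt0// sumr_ge0// => z _; exact: mu_ge0.
Qed.

Lemma nu_gt0 x : 0 < nu x.
Proof. by rewrite mulr_gt0// vertex_weight_gt0. Qed.

(** The off-diagonal part of the Laplacian, a positive operator. Together with
    outrate it splits the equation into a scalar linear equation at each vertex
    and a monotone coupling. *)
Definition inflow f x : R := \sum_(y <- nbrs x) mu G x y / nu x * f y.

Definition outrate x : R := vertex_weight G x / nu x.

Lemma outrate_ge0 x : 0 <= outrate x.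
Proof. by rewrite divr_ge0// ltW ?nu_gt0 ?vertex_weight_gt0. Qed.

Lemma laplacianE f x : laplacian f x = inflow f x - outrate x * f x.
Proof.
rewrite /laplacian /inflow /outrate /vertex_weight.
rewrite !fsbig_finite; try exact: graph_locally_finite.
rewrite -/(nbrs x) mulr_sumr 2!mulr_suml -sumrB; apply: eq_bigr => y _; ring.
Qed.

Lemma rate_ge0 x y : 0 <= mu G x y / nu x.
Proof. by rewrite divr_ge0 ?mu_ge0// ltW// nu_gt0. Qed.

Lemma inflow_ge0 f x : (forall y, 0 <= f y) -> 0 <= inflow f x.
Proof.
by move=> f0; rewrite sumr_ge0// => y _; rewrite mulr_ge0// rate_ge0.
Qed.

Lemma le_inflow f g x : (forall y, f y <= g y) -> inflow f x <= inflow g x.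
Proof. by move=> fg; apply: ler_sum => y _; rewrite ler_wpM2l// rate_ge0. Qed.

Lemma inflow_gt0 f x y : (forall z, 0 <= f z) -> adj G x y -> 0 < f y ->
  0 < inflow f x.
Proof.
move=> f0 xy fy; rewrite /inflow (big_rem y) ?mem_nbrs//=.
rewrite ltr_pwDl//; first by rewrite mulr_gt0// divr_gt0// ?mu_gt0// nu_gt0.
by rewrite sumr_ge0// => z _; rewrite mulr_ge0// rate_ge0.
Qed.

Lemma inflow_eq0 f x : (forall y, adj G x y -> f y = 0) -> inflow f x = 0.
Proof.
move=> f0; rewrite /inflow big_seq big1// => y; rewrite mem_nbrs => xy.
by rewrite f0// mulr0.
Qed.

Lemma inflow_cst (c : R) x : inflow (fun=> c) x = outrate x * c.
Proof.
rewrite /inflow /outrate /vertex_weight fsbig_finite; last first.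
  exact: graph_locally_finite.
by rewrite -mulr_suml -mulr_suml.
Qed.

Lemma laplacianB f g x :
  laplacian (fun y => f y - g y) x = laplacian f x - laplacian g x.
Proof.
rewrite !laplacianE /inflow.
under eq_bigr do rewrite mulrBr.
by rewrite sumrB; ring.
Qed.

Lemma laplacianZ (c : R) f x :
  laplacian (fun y => c * f y) x = c * laplacian f x.
Proof.
rewrite !laplacianE /inflow mulrBr mulr_sumr; congr (_ - _); last by ring.
by apply: eq_bigr => y _; ring.
Qed.

Lemma inflow_cvg (T : Type) (F : set_system T) (FF : Filter F)
    (h : T -> V -> R) f x : (forall y, h s y @[s --> F] --> f y) ->
  inflow (h s) x @[s --> F] --> inflow f x.
Proof.
move=> hf; apply: cvg_big => [|y _]; first exact: add_continuous.
by apply: cvgM; [exact: cvg_cst|exact: hf].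
Qed.

Lemma laplacian_sum (I : Type) (r : seq I) (c : I -> R) (F : I -> V -> R) x :
  laplacian (fun y => \sum_(i <- r) c i * F i y) x =
  \sum_(i <- r) c i * laplacian (F i) x.
Proof.
rewrite laplacianE /inflow.
under eq_bigr do rewrite mulr_sumr.
rewrite exchange_big mulr_sumr -sumrB; apply: eq_bigr => i _.
rewrite laplacianE /inflow mulrBr mulr_sumr; congr (_ - _); last by ring.
by apply: eq_bigr => y _; ring.
Qed.

Lemma laplacian_cst (c : R) x : laplacian (fun=> c) x = 0.
Proof. by rewrite laplacianE inflow_cst subrr. Qed.

Lemma laplacian_min_ge0 f x : (forall y, f x <= f y) -> 0 <= laplacian f x.
Proof.
by move=> fx; rewrite laplacianE subr_ge0 -inflow_cst; exact: le_inflow.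
Qed.

(** If z is negative at some (T, x0), add a multiple e * (1 + t) too small to
    make it nonnegative there, and take a minimum over [0, T] * D. It is
    negative, hence not attained at time 0. At that point the time derivative is
    nonpositive, while the Laplacian is nonnegative because z is nonnegative
    outside D; but the added term makes the time derivative exceed the
    Laplacian by at least e > 0. *)
Lemma weak_minimum_principle D (z : R -> V -> R) :
  finite_set D ->
  (forall x, D x -> continuous (z^~ x)) ->
  (forall (t : R) x, 0 < t -> D x ->
     exists2 dz, is_derive t 1 (z^~ x) dz & laplacian (z t) x <= dz) ->
  (forall x, D x -> 0 <= z 0 x) ->
  (forall t x, 0 <= t -> ~ D x -> 0 <= z t x) ->
  forall t x, 0 <= t -> 0 <= z t x.
Proof.
move=> finD cz dz z0 zout T x0 T0.
have [Dx0|] := pselect (D x0); last exact: zout.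
rewrite leNgt; apply/negP => zT.
(* Half of the e for which z + e * (1 + t) vanishes at (T, x0). *)
pose e := - z T x0 / (1 + T) / 2.
have e0 : 0 < e by rewrite !divr_gt0 ?oppr_gt0// ltr_wpDr.
pose g t x := z t x + e * (1 + t).
have gT : g T x0 < 0.
  rewrite /g /e (_ : _ * (1 + T) = - z T x0 / 2); first by lra.
  by field; lra.
have cg x : D x -> continuous (g^~ x).
  move=> Dx; apply: continuous_add; first exact: cz.
  apply: continuous_mul; first exact: cst_continuous.
  by apply: continuous_add => t; [exact: cst_continuous|exact: cvg_id].
have minx x : exists c, D x -> 0 <= c <= T /\
    forall t, 0 <= t <= T -> g c x <= g t x.
  have [Dx|nDx] := pselect (D x); last by exists 0.
  have [c] := EVT_min T0 (continuous_subspaceT (cg x Dx)).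
  by rewrite in_itv/= => cT cmin; exists c.
have [c cP] := choice minx.
pose s := fset_set D.
have memD x : (x \in s) = (x \in D) by rewrite in_fset_set.
have [x1 Dx1 x1min] :
    exists2 x1, D x1 & forall x, D x -> g (c x1) x1 <= g (c x) x.
  have [|i] := @exists_seq_min _ _ _ (fun x => g (c x) x) s x0.
    by rewrite memD inE.
  rewrite memD inE => Di imin; exists i => // x Dx; apply: imin.
  by rewrite memD inE.
set t1 := c x1.
have [/andP[t10 t1T] t1min] := cP x1 Dx1.
have gt1 : g t1 x1 < 0.
  apply: le_lt_trans gT; apply: le_trans (x1min _ Dx0) _.
  have [_] := cP x0 Dx0; apply.
  by rewrite T0 lexx.
have t1gt0 : 0 < t1.
  rewrite lt_def t10 andbT; apply/negP => /eqP t1E.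
  by move: gt1; rewrite t1E /g; have := z0 x1 Dx1; lra.
have [d dzd ld] := dz t1 x1 t1gt0 Dx1.
have lap0 : 0 <= laplacian (z t1) x1.
  apply: laplacian_min_ge0 => y.
  have [Dy|nDy] := pselect (D y).
    have : g t1 x1 <= g t1 y.
      apply: le_trans (x1min _ Dy) _; have [_] := cP y Dy; apply.
      by rewrite t10 t1T.
    by rewrite /g lerD2r.
  apply: le_trans (zout t1 y t10 nDy).
  have : 0 <= e * (1 + t1) by rewrite mulr_ge0 ?(ltW e0)// addr_ge0.
  by move: gt1; rewrite /g; lra.
have dg : is_derive t1 1 (g^~ x1) (d + e).
  have de : is_derive t1 1 (fun t : R => e * (1 + t)) e.
    by apply: is_derive_eq; rewrite add0r -![_ *: _]/(_ * _) mulr1.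
  exact: is_deriveD.
suff : d + e <= 0 by lra.
apply: (derive_left_min_le0 t1gt0 dg) => s0 /andP[s00 s0t].
by apply: t1min; rewrite s00 (le_trans s0t).
Qed.
End Graph.

(** * The Dirichlet semigroup of a finite set *)

(** Comparison with the exponential series of C * `|t|. *)
Lemma cvg_pseries_exp_bound (R : realType) (a : R^nat) (K C t : R) :
  0 <= C -> (forall n, `|a n| <= K * C ^+ n / n`!%:R) -> cvgn (pseries a t).
Proof.
move=> C0 aK; apply: normed_cvg; rewrite /normed_series_of.
apply: (@series_le_cvg _ _ (fun n => K * exp_coeff (C * `|t|) n)).
- by move=> n; exact: normr_ge0.
- move=> n; rewrite mulr_ge0//; last by rewrite exp_coeff_ge0// mulr_ge0.
  by have := le_trans (normr_ge0 _) (aK 0%N); rewrite expr0 fact0 divr1 mulr1.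
- move=> n /=; rewrite normrM normrX /exp_coeff/= exprMn.
  rewrite (_ : K * _ = K * C ^+ n / n`!%:R * `|t| ^+ n); last by ring.
  by rewrite ler_wpM2r// exprn_ge0.
- rewrite (_ : (fun n => _) = K *: exp_coeff (C * `|t|)); last exact/funext.
  exact/is_cvg_seriesZ/is_cvg_series_exp_coeff.
Qed.

Section DirichletSemigroup.
Context {R : realType} {V : choiceType}.
Variables (G : weighted_graph R V) (sigma : V -> R).
Hypothesis sigma_gt0 : forall x, 0 < sigma x.
Local Notation nu := (nu G sigma).
Local Notation laplacian := (laplacian G sigma).
Local Notation inflow := (inflow G sigma).
Local Notation outrate := (outrate G sigma).
Local Notation semigroup := (dirichlet_semigroup G sigma).
Implicit Types (f g : V -> R) (x y z : V) (D : set V) (s t : R).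

Lemma zero_outside_in D f x : D x -> zero_outside D f x = f x.
Proof. by move=> Dx; rewrite /zero_outside patchE mem_set. Qed.

Lemma zero_outside_out D f x : ~ D x -> zero_outside D f x = 0.
Proof. by move=> nDx; rewrite /zero_outside patchE memNset. Qed.

Lemma zero_outside_ge0 D f x : (forall y, 0 <= f y) -> 0 <= zero_outside D f x.
Proof.
move=> f0; have [Dx|nDx] := pselect (D x); first by rewrite zero_outside_in.
by rewrite zero_outside_out.
Qed.

Definition laplacian_power D n f : V -> R :=
  iter n (dirichlet_laplacian G sigma D) (zero_outside D f).

Lemma laplacian_power_out D n f x : ~ D x -> laplacian_power D n f x = 0.
Proof. by move=> nDx; case: n => [|n]; exact: zero_outside_out. Qed.

Lemma laplacian_powerS D n f x : D x ->
  laplacian_power D n.+1 f x = laplacian (laplacian_power D n f) x.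
Proof.
move=> Dx.
rewrite /laplacian_power iterS {1}/dirichlet_laplacian zero_outside_in//.
congr (laplacian _ x); apply/funext => y.
have [Dy|nDy] := pselect (D y); first by rewrite zero_outside_in.
by rewrite zero_outside_out//; apply/esym; exact: laplacian_power_out.
Qed.

Lemma laplacian_bound f x (K : R) : (forall y, `|f y| <= K) ->
  `|laplacian f x| <= 2 * outrate x * K.
Proof.
move=> fK; rewrite laplacianE.
apply: le_trans (ler_normB _ _) _.
rewrite (_ : 2 * _ * _ = outrate x * K + outrate x * K); last by ring.
apply: lerD; last first.
  by rewrite normrM ger0_norm ?outrate_ge0// ler_wpM2l// outrate_ge0.
rewrite -inflow_cst /inflow; apply: le_trans (ler_norm_sum _ _ _) _.
apply: ler_sum => y _; rewrite normrM ger0_norm ?rate_ge0//.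
by rewrite ler_wpM2l// rate_ge0.
Qed.

(** On a finite set the Dirichlet Laplacian is a bounded operator for the
    supremum norm; the sum C over D bounds every 2 * outrate x with x in D. *)
Lemma laplacian_power_bound D : finite_set D -> exists2 C : R, 0 <= C &
  forall f, exists K, forall n x, `|laplacian_power D n f x| <= K * C ^+ n.
Proof.
move=> finD; pose C := \sum_(x <- fset_set D) 2 * outrate x.
have lesum (h : V -> R) x : (forall y, 0 <= h y) -> D x ->
    h x <= \sum_(x <- fset_set D) h x.
  move=> h0 Dx; have xD : x \in fset_set D by rewrite in_fset_set// inE.
  by rewrite (big_rem x)//= lerDl sumr_ge0.
have h0 y : 0 <= 2 * outrate y by rewrite mulr_ge0// outrate_ge0.
have C0 : 0 <= C by rewrite sumr_ge0.
exists C => // f; exists (\sum_(x <- fset_set D) `|f x|) => n.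
elim: n => [|n IHn] x.
  rewrite expr0 mulr1 /laplacian_power/=.
  have [Dx|nDx] := pselect (D x).
    by rewrite zero_outside_in//; apply: (lesum (fun x => `|f x|)).
  by rewrite zero_outside_out// normr0 sumr_ge0.
have [Dx|nDx] := pselect (D x); last first.
  by rewrite laplacian_power_out// normr0 mulr_ge0 ?exprn_ge0 ?sumr_ge0.
rewrite laplacian_powerS//; apply: le_trans (laplacian_bound _ IHn) _.
rewrite exprS [leRHS]mulrCA ler_wpM2r//; last first.
  exact: (lesum (fun x => 2 * outrate x)).
by rewrite mulr_ge0 ?exprn_ge0 ?sumr_ge0.
Qed.

Lemma semigroupE D t f x :
  semigroup D t f x =
  limn (pseries (fun n => laplacian_power D n f x / n`!%:R) t).
Proof.
congr (limn _); apply/funext => n; rewrite /pseries /series/=.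
by apply: eq_bigr => i _; rewrite /exp_coeff/= /laplacian_power; ring.
Qed.

Lemma semigroup_cvg D t f x : finite_set D ->
  pseries (fun n => laplacian_power D n f x / n`!%:R) t @ \oo -->
  semigroup D t f x.
Proof.
move=> finD; have [C C0 /(_ f)[K LK]] := laplacian_power_bound finD.
rewrite semigroupE; apply: (@cvg_pseries_exp_bound _ _ K C) => // n.
by rewrite normrM (@ger0_norm _ (_^-1)) ?invr_ge0// ler_wpM2r ?invr_ge0//.
Qed.

Lemma semigroup_out D t f x : ~ D x -> semigroup D t f x = 0.
Proof.
move=> nDx; rewrite semigroupE (_ : pseries _ _ = cst 0) ?lim_cst//.
apply/funext => n; rewrite /pseries /series/= big1// => i _.
by rewrite laplacian_power_out// mul0r mul0r.
Qed.

Lemma semigroup0 D f x : semigroup D 0 f x = zero_outside D f x.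
Proof.
rewrite semigroupE; apply: cvg_lim => //; rewrite -cvg_shiftS.
rewrite (_ : (fun n => _) = cst (zero_outside D f x)); first exact: cvg_cst.
apply/funext => n; rewrite /pseries /series/= big_nat_recl//=.
rewrite expr0 fact0 mulr1 divr1.
by rewrite big1 ?addr0// => i _; rewrite expr0n mulr0.
Qed.

(** Termwise differentiation of the power series: it shifts the coefficients
    by one power of the Dirichlet Laplacian, which is a finite sum and commutes
    with the limit. *)
Lemma semigroup_derive D t f x : finite_set D -> D x ->
  is_derive t 1 (fun s => semigroup D s f x) (laplacian (semigroup D t f) x).
Proof.
move=> finD Dx; have [C C0 /(_ f)[K LK]] := laplacian_power_bound finD.
(* The coefficients of the m-th derivative of the series in t. *)
pose c (m n : nat) : R := laplacian_power D (n + m) f x / n`!%:R.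
have cdiff m : pseries_diffs (c m) = c m.+1.
  apply/funext => n; rewrite /pseries_diffs /c factS natrM invfM addSnnS.
  by rewrite mulrCA mulVKf.
have ccvg m s : cvgn (pseries (c m) s).
  apply: (@cvg_pseries_exp_bound _ _ (K * C ^+ m) C) => // n.
  rewrite normrM (@ger0_norm _ (_^-1)) ?invr_ge0// ler_wpM2r ?invr_ge0//.
  by rewrite -mulrA -exprD addnC.
have := @pseries_snd_diffs _ (c 0) (`|t| + 1) t.
rewrite !cdiff (@ger0_norm _ (`|t| + 1)) ?addr_ge0// ltrDl ltr01.
move=> /(_ _ _ _ isT) H.
rewrite (_ : (fun s => _) = (fun s => limn (pseries (c 0) s))); last first.
  apply/funext => s; rewrite semigroupE; congr (limn (pseries _ _)).
  by apply/funext => n; rewrite /c addn0.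
apply: is_derive_eq; first exact: H.
apply: cvg_lim => //.
rewrite laplacianE.
rewrite (_ : pseries (c 1) t = (fun n => inflow (fun y =>
    pseries (fun n => laplacian_power D n f y / n`!%:R) t n) x -
    outrate x * pseries (fun n => laplacian_power D n f x / n`!%:R) t n)).
  apply: cvgB; last by apply: cvgM; [exact: cvg_cst|exact: semigroup_cvg].
  by apply: inflow_cvg => y; exact: semigroup_cvg.
apply/funext => n; rewrite -laplacianE.
rewrite /pseries /series/= /c.
have -> : (fun y =>
      \sum_(0 <= k < n) laplacian_power D k f y / k`!%:R * t ^+ k) =
    (fun y => \sum_(0 <= k < n) (t ^+ k / k`!%:R) * laplacian_power D k f y).
  by apply/funext => y; apply: eq_bigr => k _; ring.
rewrite laplacian_sum; apply: eq_bigr => k _.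
by rewrite addn1 laplacian_powerS//; ring.
Qed.

End DirichletSemigroup.

(** * Comparison of heat kernels *)

Lemma eq_big_support (R : nmodType) (T : eqType) (r1 r2 : seq T) (F : T -> R) :
  uniq r1 -> uniq r2 ->
  (forall x, x \in r1 -> x \notin r2 -> F x = 0) ->
  (forall x, x \in r2 -> x \notin r1 -> F x = 0) ->
  \sum_(x <- r1) F x = \sum_(x <- r2) F x.
Proof.
move=> u1 u2 F1 F2.
have sub (r s : seq T) : (forall x, x \in r -> x \notin s -> F x = 0) ->
    \sum_(x <- r) F x = \sum_(x <- [seq x <- r | x \in s]) F x.
  move=> F0; rewrite big_filter (bigID (mem s))/= [X in _ + X]big_seq_cond.
  by rewrite [X in _ + X]big1 ?addr0// => x /andP[xr xs]; exact: F0.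
rewrite (sub _ _ F1) (sub _ _ F2); apply: perm_big; apply: uniq_perm.
- exact: filter_uniq.
- exact: filter_uniq.
- by move=> x; rewrite !mem_filter andbC.
Qed.

Section HeatKernelComparison.
Context {R : realType} {V : choiceType}.
Variables (G : weighted_graph R V) (sigma : V -> R).
Hypothesis sigma_gt0 : forall x, 0 < sigma x.
Local Notation nu := (nu G sigma).
Local Notation laplacian := (laplacian G sigma).
Local Notation inflow := (inflow G sigma).
Local Notation outrate := (outrate G sigma).
Local Notation semigroup := (dirichlet_semigroup G sigma).
Local Notation heat_kernel := (dirichlet_heat_kernel G sigma).
Local Notation laplacian_power := (laplacian_power G sigma).
Implicit Types (f g : V -> R) (x y z : V) (D : set V) (s t : R).

Let nu0 x : nu x != 0. Proof. by rewrite gt_eqF// nu_gt0. Qed.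

Let nuV_ge0 x : 0 <= (nu x)^-1. Proof. by rewrite invr_ge0 ltW// nu_gt0. Qed.

(** The weight mu vanishes between vertices that are not adjacent, and f
    vanishes outside D, so both sums reduce to the neighbours of x in D. *)
Lemma inflow_supportE D f x : finite_set D -> (forall y, ~ D y -> f y = 0) ->
  inflow f x = \sum_(y <- fset_set D) mu G x y / nu x * f y.
Proof.
move=> finD f0; apply: eq_big_support; rewrite ?finmap.fset_uniq//.
  by move=> y _; rewrite in_fset_set// notin_setE => nDy; rewrite f0// mulr0.
by move=> y _; rewrite mem_nbrs => /mu_eq0 ->; rewrite !mul0r.
Qed.

(** Multiplying by nu clears the denominators and leaves the symmetric matrix mu
    plus a diagonal. *)
Lemma laplacian_sym D f g : finite_set D ->
  (forall y, ~ D y -> f y = 0) -> (forall y, ~ D y -> g y = 0) ->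
  \sum_(x <- fset_set D) nu x * (f x * laplacian g x) =
  \sum_(x <- fset_set D) nu x * (laplacian f x * g x).
Proof.
move=> finD f0 g0.
have H (h k : V -> R) :
  (forall y, ~ D y -> h y = 0) -> (forall y, ~ D y -> k y = 0) ->
  \sum_(x <- fset_set D) nu x * (h x * laplacian k x) =
  \sum_(x <- fset_set D) \sum_(y <- fset_set D) mu G x y * h x * k y -
  \sum_(x <- fset_set D) nu x * (outrate x * (h x * k x)).
  move=> h0 k0; rewrite -sumrB; apply: eq_bigr => x _.
  rewrite laplacianE (inflow_supportE _ finD k0) !mulrBr.
  congr (_ - _); last by ring.
  rewrite !mulr_sumr; apply: eq_bigr => y _.
  by field; exact: nu0.
under [in RHS]eq_bigr do rewrite [laplacian f _ * _]mulrC.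
rewrite !H//; congr (_ - _); last first.
  by apply: eq_bigr => x _; rewrite [f x * _]mulrC.
rewrite exchange_big; apply: eq_bigr => x _; apply: eq_bigr => y _.
by rewrite mu_sym; ring.
Qed.

Lemma laplacian_power_pairing D f g m n : finite_set D ->
  \sum_(x <- fset_set D)
    nu x * (laplacian_power D n f x * laplacian_power D m g x) =
  \sum_(x <- fset_set D)
    nu x * (zero_outside D f x * laplacian_power D (n + m) g x).
Proof.
move=> finD; elim: n m => [//|n IHn] m.
rewrite addSnnS -IHn.
have inD x : x \in fset_set D -> D x by rewrite in_fset_set// inE.
rewrite !big_seq.
under eq_bigr => x /inD Dx do rewrite laplacian_powerS//.
under [RHS]eq_bigr => x /inD Dx do rewrite laplacian_powerS//.
by rewrite -!big_seq laplacian_sym// => y nDy; rewrite laplacian_power_out.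
Qed.

(** Pairing with the indicators of x and y and moving the n factors from one
    side to the other, one at a time. *)
Lemma laplacian_power_sym D n x y : finite_set D -> D x -> D y ->
  nu x * laplacian_power D n \1_[set y] x =
  nu y * laplacian_power D n \1_[set x] y.
Proof.
move=> finD Dx Dy.
have pick (h : V -> R) z : D z -> \sum_(w <- fset_set D)
    nu w * (h w * laplacian_power D 0 \1_[set z] w) = nu z * h z.
  move=> Dz; have zD : z \in fset_set D by rewrite in_fset_set// inE.
  rewrite (big_rem z)//= big_seq big1 ?addr0.
    by rewrite /laplacian_power/= zero_outside_in// indicE mem_set// mulr1.
  move=> w; rewrite mem_rem_uniq ?finmap.fset_uniq// => /andP[/= wz wD].
  rewrite /laplacian_power/= zero_outside_in; last first.
    by move: wD; rewrite in_fset_set// inE.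
  by rewrite indicE memNset ?mulr0//=; exact/eqP.
rewrite -pick// laplacian_power_pairing// addn0 -(pick _ y)//.
by apply: eq_bigr => w _; rewrite [_ * laplacian_power _ 0 _ _]mulrC.
Qed.

(** The hypothesis on the minimal kernel concerns x |-> p(t, o, x), whereas the
    flow started at o is x |-> nu(o) * p(t, x, o). *)
Lemma heat_kernel_sym D t x y : finite_set D -> D x -> D y ->
  heat_kernel D t x y = heat_kernel D t y x.
Proof.
move=> finD Dx Dy; rewrite /dirichlet_heat_kernel.
suff : nu x * semigroup D t \1_[set y] x = nu y * semigroup D t \1_[set x] y.
  move=> H; apply: (mulfI (nu0 x)); apply: (mulfI (nu0 y)).
  rewrite [nu x * (_ / _)]mulrA H; field; exact/andP.
have c w z :
    nu w * pseries (fun n => laplacian_power D n \1_[set z] w / n`!%:R) t m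
    @[m --> \oo] --> nu w * semigroup D t \1_[set z] w.
  by apply: cvgM; [exact: cvg_cst|exact: semigroup_cvg].
rewrite -(cvg_lim (@Rhausdorff R) (c x y)) -(cvg_lim (@Rhausdorff R) (c y x)).
congr (limn _); apply/funext => n /=.
rewrite /pseries /series/= !mulr_sumr; apply: eq_bigr => i _.
by rewrite !mulrA laplacian_power_sym.
Qed.

Lemma semigroup_continuous D f x : finite_set D ->
  continuous (fun t => semigroup D t f x).
Proof.
move=> finD t; have [Dx|nDx] := pselect (D x); last first.
  rewrite (_ : (fun s => _) = cst 0); first exact: cst_continuous.
  by apply/funext => s; exact: semigroup_out.
apply: differentiable_continuous; apply/derivable1_diffP.
have ds := semigroup_derive G sigma_gt0 t f finD Dx.
exact: (@ex_derive _ _ _ _ _ _ _ ds).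
Qed.

Lemma semigroup_ge0 D t f x : finite_set D -> (forall y, 0 <= f y) -> 0 <= t ->
  0 <= semigroup D t f x.
Proof.
move=> finD f0 t0.
apply: (weak_minimum_principle sigma_gt0 finD
  (z := fun t x => semigroup D t f x)) => //.
- by move=> y Dy; exact: semigroup_continuous.
- move=> s y s0 Dy; exists (laplacian (semigroup D s f) y) => //.
  exact: semigroup_derive.
- by move=> y Dy; rewrite semigroup0 zero_outside_ge0.
- by move=> s y s0 nDy; rewrite semigroup_out.
Qed.

(** Constants are harmonic and c >= 0 = semigroup outside D, so c - semigroup
    falls under the minimum principle. *)
Lemma semigroup_le_cst D t f x (c : R) : finite_set D -> 0 <= c ->
  (forall y, f y <= c) -> 0 <= t -> semigroup D t f x <= c.
Proof.
move=> finD c0 fc t0; rewrite -subr_ge0.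
apply: (weak_minimum_principle sigma_gt0 finD
  (z := fun t x => c - semigroup D t f x)) => //.
- move=> y Dy s; apply: continuousB; first exact: cst_continuous.
  exact: semigroup_continuous.
- move=> s y s0 Dy; have ds := semigroup_derive G sigma_gt0 s f finD Dy.
  exists (0 - laplacian (semigroup D s f) y); first exact: is_deriveB.
  by rewrite (laplacianB _ _ (fun=> c)) laplacian_cst.
- by move=> y Dy; rewrite semigroup0 zero_outside_in// subr_ge0.
- by move=> s y s0 nDy; rewrite semigroup_out// subr0.
Qed.

(** The difference solves the heat equation in D, starts from 0 there, and is
    nonnegative outside D, where the flow of the smaller domain vanishes. *)
Lemma semigroup_le_domain D D' t f x : finite_set D' -> D `<=` D' ->
  (forall y, 0 <= f y) -> 0 <= t -> semigroup D t f x <= semigroup D' t f x.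
Proof.
move=> finD' DD' f0 t0; rewrite -subr_ge0.
have finD : finite_set D by exact: sub_finite_set DD' _.
apply: (weak_minimum_principle sigma_gt0 finD
  (z := fun t x => semigroup D' t f x - semigroup D t f x)) => //.
- move=> y Dy s; apply: continuousB; last exact: semigroup_continuous.
  exact: semigroup_continuous.
- move=> s y s0 Dy; have ds := semigroup_derive G sigma_gt0 s f finD Dy.
  have ds' := semigroup_derive G sigma_gt0 s f finD' (DD' _ Dy).
  exists (laplacian (semigroup D' s f) y - laplacian (semigroup D s f) y).
    exact: is_deriveB.
  by rewrite laplacianB.
- by move=> y Dy; rewrite !semigroup0 !zero_outside_in ?subrr//; exact: DD'.
- by move=> s y s0 nDy; rewrite [X in _ - X]semigroup_out// subr0 semigroup_ge0.
Qed.

Fixpoint graph_ball (o : V) (n : nat) : set V :=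
  if n is m.+1 then
    graph_ball o m `|` \bigcup_(x in graph_ball o m) neighbours (adj G) x
  else [set o].

Lemma graph_ball_finite o n : finite_set (graph_ball o n).
Proof.
elim: n => [|n IHn] /=; first exact: finite_set1.
rewrite finite_setU; split => //.
by apply: bigcup_finite => // x _; exact: graph_locally_finite.
Qed.

Lemma sub_graph_ball o m n : (m <= n)%N -> graph_ball o m `<=` graph_ball o n.
Proof.
elim: n => [|n IHn]; first by rewrite leqn0 => /eqP ->.
rewrite leq_eqVlt => /predU1P[->//|/IHn mn] x /mn; by left.
Qed.

Lemma graph_ball_center o n : graph_ball o n o.
Proof. by apply: (@sub_graph_ball o 0) => //. Qed.

Lemma graph_ball_adj o n x y :
  graph_ball o n x -> adj G x y -> graph_ball o n.+1 y.
Proof. by move=> ox xy; right; exists x. Qed.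

(** A path from x to y in the larger ball goes one step into the smaller ball,
    follows a path there, and leaves by one step. Either step may be empty. *)
Lemma graph_ball_connected o n : connected_in (adj G) (graph_ball o n).
Proof.
elim: n => [|n IHn] x y.
  by move=> /= -> ->; exists [::]; split.
have step z : graph_ball o n.+1 z ->
    exists2 w, graph_ball o n w & w = z \/ adj G w z.
  by move=> [oz|[w ow wz]]; [exists z => //; left|exists w => //; right].
move=> Bx By.
have [x' Bx' xx'] := step _ Bx; have [y' By' yy'] := step _ By.
have [p [px' ly' pB]] := IHn _ _ Bx' By'.
pose p1 := if x' == x then p else x' :: p.
have [p1x p1l p1B] : [/\ path (adj G) x p1, last x p1 = y' &
    forall z, z \in p1 -> graph_ball o n z].
  rewrite /p1; case: eqP => [<-//|]; case: xx' => // x'x _.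
  split => //=; first by rewrite adj_sym x'x.
  by move=> z; rewrite in_cons => /predU1P[->|/pB].
exists (if y' == y then p1 else rcons p1 y).
case: eqP => [<-|].
  by split => // z /p1B; left.
case: yy' => // y'y _; split; first by rewrite rcons_path p1x p1l.
  by rewrite last_rcons.
by move=> z; rewrite mem_rcons in_cons => /predU1P[->//|/p1B]; left.
Qed.

Lemma graph_ball_exhaustion o : exhaustion G (graph_ball o).
Proof.
split => [j|j|].
- split; [exact: graph_ball_finite|exists o; exact: graph_ball_center|].
  exact: graph_ball_connected.
- exact: sub_graph_ball.
- apply/seteqP; split => // y _.
  have [p [px <- _]] := @graph_connected _ _ G o y I I.
  exists (size p) => //=.
  elim/last_ind: p px => [_|p z IHp]; first exact: graph_ball_center.
  rewrite rcons_path size_rcons last_rcons => /andP[/IHp].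
  exact: graph_ball_adj.
Qed.

Lemma exhaustion_absorbs E D : exhaustion G E -> finite_set D ->
  exists j, D `<=` E j.
Proof.
move=> [_ Esub Ecov] finD.
have mono m n : (m <= n)%N -> E m `<=` E n.
  elim: n => [|n IHn]; first by rewrite leqn0 => /eqP ->.
  rewrite leq_eqVlt => /predU1P[->//|/IHn mn] x /mn; exact: Esub.
have cover x : exists j, E j x.
  have : (\bigcup_j E j) x by rewrite Ecov.
  by move=> [j _ Ejx]; exists j.
have [h hP] := choice cover.
exists (\max_(x <- fset_set D) h x)%N => x Dx.
apply: mono (hP x); apply: leq_bigmax_seq => //.
by rewrite in_fset_set// inE.
Qed.

Lemma heat_kernel_ge0 D t x y : finite_set D -> 0 <= t ->
  0 <= heat_kernel D t x y.
Proof.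
move=> finD t0; rewrite mulr_ge0//.
by apply: semigroup_ge0 => // z; rewrite indicE.
Qed.

Lemma heat_kernel_le_domain D D' t x y : finite_set D' -> D `<=` D' -> 0 <= t ->
  heat_kernel D t x y <= heat_kernel D' t x y.
Proof.
move=> finD' DD' t0; rewrite ler_wpM2r//.
by apply: semigroup_le_domain => // z; rewrite indicE.
Qed.

Lemma heat_kernel_le D t x y : finite_set D -> 0 <= t ->
  heat_kernel D t x y <= (nu y)^-1.
Proof.
move=> finD t0; rewrite ler_piMl//.
by apply: semigroup_le_cst => // z; rewrite indicE; case: (_ \in _).
Qed.

Lemma heat_kernel_cvg E t x y : exhaustion G E -> 0 <= t ->
  heat_kernel (E j) t x y @[j --> \oo] -->
  sup (range (fun j => heat_kernel (E j) t x y)).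
Proof.
move=> [Efin Esub _] t0; apply: nondecreasing_cvgn.
  apply/nondecreasing_seqP => j; apply: heat_kernel_le_domain => //.
  by have [] := Efin j.+1.
exists (nu y)^-1 => _ [j _ <-]; apply: heat_kernel_le => //.
by have [] := Efin j.
Qed.

(** Each member of one exhaustion is contained in a member of the other one, so
    the limits along any two exhaustions agree. *)
Lemma sup_heat_kernel_le E E' t x y :
  exhaustion G E -> exhaustion G E' -> 0 <= t ->
  sup (range (fun j => heat_kernel (E j) t x y)) <=
  sup (range (fun j => heat_kernel (E' j) t x y)).
Proof.
move=> exE exE' t0; apply: ge_sup.
  by exists (heat_kernel (E 0) t x y), 0%N.
move=> _ [j _ <-]; have [Efin _ _] := exE; have [E'fin _ _] := exE'.
have [finEj _ _] := Efin j.
have [k Ejk] := exhaustion_absorbs exE' finEj.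
have [finE'k _ _] := E'fin k.
apply: le_trans (heat_kernel_le_domain x y finE'k Ejk t0) _.
apply: ub_le_sup; last by exists k.
exists (nu y)^-1 => _ [i _ <-]; apply: heat_kernel_le => //.
by have [] := E'fin i.
Qed.

Lemma minimal_heat_kernelP E t x y : exhaustion G E -> 0 <= t ->
  heat_kernel (E j) t x y @[j --> \oo] --> minimal_heat_kernel G sigma t x y.
Proof.
move=> exE t0; rewrite /minimal_heat_kernel.
set P := [set l : R | _].
suff : P (xget 0 P) by apply.
apply: xgetPex.
exists (sup (range (fun j => heat_kernel (graph_ball x j) t x y))) => E' exE'.
suff -> : sup (range (fun j => heat_kernel (graph_ball x j) t x y)) =
    sup (range (fun j => heat_kernel (E' j) t x y)).
  exact: heat_kernel_cvg.
have exB := graph_ball_exhaustion x.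
by apply/eqP; rewrite eq_le !sup_heat_kernel_le.
Qed.

Lemma heat_kernel_le_minimal D t x y : finite_set D -> 0 <= t ->
  heat_kernel D t x y <= minimal_heat_kernel G sigma t x y.
Proof.
move=> finD t0; have exB := graph_ball_exhaustion x.
have [j Dj] := exhaustion_absorbs exB finD.
apply: le_trans (heat_kernel_le_domain x y (graph_ball_finite x j) Dj t0) _.
have cB := @minimal_heat_kernelP _ t x y exB t0.
rewrite -(cvg_lim (@Rhausdorff R) cB).
apply: (nondecreasing_cvgn_le _ (cvgP _ cB)).
apply/nondecreasing_seqP => i; apply: heat_kernel_le_domain => //.
  exact: graph_ball_finite.
exact: sub_graph_ball.
Qed.

End HeatKernelComparison.

(** * Monotone iteration for the semilinear equation *)

Section Picard.
Context {R : realType} {V : choiceType}.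
Variables (G : weighted_graph R V) (sigma : V -> R).
Hypothesis sigma_gt0 : forall x, 0 < sigma x.
Variables (q : R) (q_gt1 : 1 < q) (o : V) (a : R) (a_gt0 : 0 < a).
Local Notation laplacian := (laplacian G sigma).
Local Notation inflow := (inflow G sigma).
Local Notation outrate := (outrate G sigma).
Implicit Types (f g : V -> R) (x y z : V) (D : set V) (s t : R).

Let q_gt0 : 0 < q. Proof. exact: lt_trans q_gt1. Qed.
Let q_ge0 : 0 <= q. Proof. exact: ltW. Qed.

Definition datum x : R := a * \1_[set o] x.

Lemma datum_ge0 x : 0 <= datum x.
Proof. by rewrite mulr_ge0 ?(ltW a_gt0)// indicE. Qed.

(** What drives u at x in u' = forcing u - outrate * u; it is monotone on
    nonnegative functions. *)
Definition forcing f x : R := inflow f x + f x `^ q.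

Lemma forcing_ge0 f x : (forall y, 0 <= f y) -> 0 <= forcing f x.
Proof. by move=> f0; rewrite addr_ge0 ?powR_ge0 ?inflow_ge0. Qed.

Lemma le_forcing f g x : (forall y, 0 <= f y) -> (forall y, f y <= g y) ->
  forcing f x <= forcing g x.
Proof.
move=> f0 fg; apply: lerD; first exact: le_inflow.
by rewrite ge0_ler_powR ?nnegrE// (le_trans (f0 x)).
Qed.

Lemma forcing_cvg (T : Type) (F : set_system T) (FF : Filter F)
    (h : T -> V -> R) f x :
  (forall i y, 0 <= h i y) -> (forall y, 0 <= f y) ->
  (forall y, h i y @[i --> F] --> f y) ->
  forcing (h i) x @[i --> F] --> forcing f x.
Proof.
move=> h0 f0 hf; apply: cvgD; first exact: inflow_cvg.
by apply: cvg_powR_ge0 => //; exact: hf.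
Qed.

Fixpoint picard (n : nat) : R -> V -> R :=
  if n is m.+1 then
    fun t x => duhamel (outrate x) (datum x) (fun s => forcing (picard m s) x) t
  else fun _ _ => 0.

Lemma picard_ge0 n t x : 0 <= picard n t x.
Proof.
elim: n t x => [//|n IHn] t x /=; apply: le_trans (duhamel_ge _ _ _ _).
  by rewrite mulr_ge0 ?expR_ge0 ?datum_ge0.
by move=> s _; exact: forcing_ge0.
Qed.

Lemma picard_continuous n x : continuous (fun t => picard n t x).
Proof.
elim: n x => [|n IHn] x /=; first exact: cst_continuous.
apply: duhamel_continuous => T; apply: continuous_integrable_itv => s.
by apply: forcing_cvg => [i y|y|y];
  [exact: picard_ge0|exact: picard_ge0|exact: IHn].
Qed.

Lemma forcing_picard_continuous n x :
  continuous (fun s => forcing (picard n s) x).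
Proof.
move=> s.
apply: forcing_cvg => [i y|y|y]; [exact: picard_ge0|exact: picard_ge0|].
exact: picard_continuous.
Qed.

Lemma picard_le n t x : picard n t x <= picard n.+1 t x.
Proof.
elim: n t x => [|n IHn] t x; first exact: (picard_ge0 1).
apply: (@duhamel_le _ _ _ (fun s => forcing (picard n s) x)
  (fun s => forcing (picard n.+1 s) x)); [exact: forcing_picard_continuous..|].
move=> s; apply: le_forcing => y; [exact: picard_ge0|exact: IHn].
Qed.

(** One iteration spreads the support by one edge. Hence the n-th iterate can be
    compared with a Dirichlet flow of the ball of radius n. *)
Lemma picard_support n t x : ~ graph_ball G o n x -> picard n t x = 0.
Proof.
elim: n t x => [//|n IHn] t x nB /=.
have nBx : ~ graph_ball G o n x by move=> Bx; apply: nB; left.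
have -> : datum x = 0.
  rewrite /datum indicE memNset ?mulr0// => /= xo; apply: nBx.
  by rewrite xo; exact: graph_ball_center.
rewrite (_ : (fun s => _) = (fun=> 0)); first exact: duhamel00.
apply/funext => s; rewrite /forcing IHn// powR0 ?gt_eqF// addr0.
apply: inflow_eq0 => y xy; apply: IHn => By; apply: nB.
by apply: graph_ball_adj By _; rewrite adj_sym.
Qed.

(** The supersolution inequality is required in D only: outside D the iterates
    up to order n vanish and w >= 0 is enough. *)
Lemma picard_le_supersolution D (w : R -> V -> R) n :
  graph_ball G o n `<=` D ->
  (forall x, D x -> continuous (fun t => w t x)) ->
  (forall t x, 0 < t -> D x -> exists2 dw, is_derive t 1 (fun s => w s x) dw &
     laplacian (w t) x + w t x `^ q <= dw) ->
  (forall x, D x -> datum x <= w 0 x) ->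
  (forall t x, 0 <= t -> 0 <= w t x) ->
  forall t x, 0 <= t -> picard n t x <= w t x.
Proof.
move=> BD cw dw w0 w_ge0.
suff H k : (k <= n)%N -> forall t x, 0 <= t -> picard k t x <= w t x.
  exact: H.
elim: k => [_|k IHk kn] t x t0; first exact: w_ge0.
have [Dx|nDx] := pselect (D x); last first.
  rewrite picard_support; first exact: w_ge0.
  by move=> /(sub_graph_ball kn)/BD.
apply: (duhamel_le_supersolution (g := fun s => forcing (picard k s) x)
  (w := fun s => w s x)) => //.
- exact: forcing_picard_continuous.
- exact: cw.
- move=> s s0; have [e de le] := dw s x s0 Dx; exists e => //.
  apply: le_trans le; rewrite laplacianE.
  rewrite [leRHS]addrAC lerD2r; apply: le_forcing => y; first exact: picard_ge0.
  exact: (IHk (ltnW kn) _ _ (ltW s0)).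
- exact: w0.
Qed.

Variable C : R.
Hypothesis picard_bounded : forall n t x, 0 <= t -> picard n t x <= C.

Definition picard_limit t x : R := limn (fun n => picard n t x).

Lemma picard_cvg t x : 0 <= t -> picard n t x @[n --> \oo] --> picard_limit t x.
Proof.
move=> t0; apply: nondecreasing_is_cvgn.
  by apply/nondecreasing_seqP => n; exact: picard_le.
by exists C => _ [n _ <-]; exact: picard_bounded.
Qed.

Lemma picard_limit_ge0 t x : 0 <= t -> 0 <= picard_limit t x.
Proof.
move=> t0; apply: limr_ge; first exact: (cvgP _ (@picard_cvg t x t0)).
by apply: nearW => n; exact: picard_ge0.
Qed.

(** One more application of the Duhamel map to the limit. It agrees with the
    limit for t >= 0, and is continuous without knowing that the limit is. *)
Definition solution t x : R :=
  duhamel (outrate x) (datum x) (fun s => forcing (picard_limit s) x) t.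

Lemma forcing_picard_cvg x :
  (forall T, lebesgue_measure.-integrable `[0, T]
     (EFin \o (fun s => forcing (picard_limit s) x))) /\
  (forall t, 0 <= t -> picard n.+1 t x @[n --> \oo] --> solution t x).
Proof.
apply: (@duhamel_cvg _ _ _ _ _ (outrate x * C + C `^ q)).
- by move=> n; exact: forcing_picard_continuous.
- move=> s s0; apply: forcing_cvg => [n y|y|y].
  + exact: picard_ge0.
  + exact: picard_limit_ge0.
  + exact: picard_cvg.
- move=> n s s0; rewrite ger0_norm ?forcing_ge0//; last first.
    by move=> y; exact: picard_ge0.
  rewrite -inflow_cst; apply: (@le_forcing _ (fun=> C)) => y.
    exact: picard_ge0.
  exact: picard_bounded.
Qed.

Lemma solutionE t x : 0 <= t -> solution t x = picard_limit t x.
Proof.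
move=> t0; have [_ /(_ t t0) H] := forcing_picard_cvg x.
have /(cvg_lim (@Rhausdorff R)) <- := H.
apply: cvg_lim => //; have := @picard_cvg t x t0.
by rewrite -(cvg_shiftS (fun n => picard n t x)).
Qed.

Lemma solution_ge0 t x : 0 <= solution t x.
Proof.
apply: le_trans (duhamel_ge _ _ _ _).
  by rewrite mulr_ge0 ?expR_ge0 ?datum_ge0.
by move=> s s0; apply: forcing_ge0 => y; exact: picard_limit_ge0.
Qed.

Lemma solution_continuous x : continuous (fun t => solution t x).
Proof. by apply: duhamel_continuous => T; have [] := forcing_picard_cvg x. Qed.

(** The integral equation now involves a continuous function only, and the
    fundamental theorem of calculus applies to it. *)
Lemma solution_duhamel t x : solution t x =
  duhamel (outrate x) (datum x) (fun s => forcing (solution s) x) t.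
Proof.
apply: eq_duhamel => s s0; congr (forcing _ x).
by apply/funext => y; rewrite solutionE.
Qed.

Lemma forcing_solution_continuous x :
  continuous (fun s => forcing (solution s) x).
Proof.
move=> s.
apply: forcing_cvg => [i y|y|y]; [exact: solution_ge0|exact: solution_ge0|].
exact: solution_continuous.
Qed.

Lemma solution_derive t x : 0 < t ->
  is_derive t 1 (fun s => solution s x)
    (laplacian (solution t) x + solution t x `^ q).
Proof.
move=> t0; have := duhamel_derive (outrate x) (datum x)
  (@forcing_solution_continuous x) t0.
rewrite -solution_duhamel.
rewrite (_ : duhamel _ _ _ = (fun s => solution s x)); last first.
  by apply/funext => s; rewrite solution_duhamel.
by rewrite laplacianE /forcing addrAC.
Qed.

(** Positivity passes from a neighbour to y. If u vanished at (t, y), then t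
    would be a minimum of u(., y) on [0, t], so its derivative, which
    is then the inflow at y, would be nonpositive; but a neighbour is
    positive. *)
Lemma solution_gt0 t x : 0 < t -> 0 < solution t x.
Proof.
have [p [+ <- _]] := @graph_connected _ _ G o x I I.
elim/last_ind: p t => [|p y IHp] t.
  move=> _ t0 /=; apply: lt_le_trans (duhamel_ge _ _ _ _).
    by rewrite mulr_gt0 ?expR_gt0// /datum indicE mem_set// mulr1.
  by move=> s s0; apply: forcing_ge0 => z; exact: picard_limit_ge0.
rewrite rcons_path last_rcons => /andP[op py] t0.
rewrite lt_def solution_ge0 andbT; apply/negP => /eqP uty.
have : inflow (solution t) y <= 0.
  have := derive_left_min_le0 t0 (solution_derive y t0).
  rewrite laplacianE uty mulr0 subr0 powR0 ?gt_eqF// addr0; apply => s _.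
  exact: solution_ge0.
apply/negP; rewrite -ltNge; apply: inflow_gt0 (IHp t op t0) => //.
  by move=> z; exact: solution_ge0.
by rewrite adj_sym.
Qed.

Lemma solution_classical :
  positive_global_classical_solution G sigma q datum solution.
Proof.
split.
- by move=> t x _; exact: solution_ge0.
- move=> x; split; first exact/continuous_subspaceT/solution_continuous.
  split.
    move=> t t0; have ds := solution_derive x t0.
    exact: (@ex_derive _ _ _ _ _ _ _ ds).
  move=> t; rewrite in_itv/= andbT => t0.
  have dE : {near t, derive1 (fun s => solution s x) =1
      (fun s => forcing (solution s) x - outrate x * solution s x)}.
    near=> s; have s0 : 0 < s by near: s; exact: lt_nbhsr.
    have ds := solution_derive x s0.
    rewrite derive1E (@derive_val _ _ _ _ _ _ _ ds).
    by rewrite laplacianE /forcing addrAC.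
  rewrite /prop_for /continuous_at (nbhs_singleton dE).
  apply: cvg_trans (near_eq_cvg _) _; last first.
    by apply: cvgB; [exact: forcing_solution_continuous|
      apply: cvgM; [exact: cvg_cst|exact: solution_continuous]].
  by apply: filterS dE => s ->.
- move=> t x t0; have ds := solution_derive x t0.
  by rewrite derive1E (@derive_val _ _ _ _ _ _ _ ds) addrAC subrr add0r.
- by move=> x; rewrite /solution duhamel0.
- exact: solution_gt0.
Unshelve. all: by end_near. Qed.

End Picard.

(** * The supersolution and global existence *)

Section Supersolution.
Context {R : realType} {V : choiceType}.
Variables (G : weighted_graph R V) (sigma : V -> R).
Hypothesis sigma_gt0 : forall x, 0 < sigma x.
Variables (q : R) (q_gt1 : 1 < q) (o : V).
Local Notation leb := (@lebesgue_measure R).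
Local Notation nu := (nu G sigma).
Local Notation laplacian := (laplacian G sigma).
Local Notation semigroup := (dirichlet_semigroup G sigma).
Local Notation heat_kernel := (dirichlet_heat_kernel G sigma).
Implicit Types (x y z : V) (D : set V) (s t : R).

Let q1_gt0 : 0 < q - 1. Proof. by rewrite subr_gt0. Qed.
Let q1_ge0 : 0 <= q - 1. Proof. exact: ltW. Qed.

Definition kernel_max D t : R :=
  \big[Num.max/0]_(x <- fset_set D) heat_kernel D t o x.

Lemma kernel_max_ge0 D t : 0 <= kernel_max D t.
Proof. exact: bigmax_ge_id. Qed.

Lemma kernel_le_max D t x : finite_set D -> D x ->
  heat_kernel D t o x <= kernel_max D t.
Proof.
move=> finD Dx.
apply: (@le_bigmax_seq _ _ _ _ _ x _ (fun x => heat_kernel D t o x)) => //.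
by rewrite in_fset_set// inE.
Qed.

Lemma kernel_max_le D t : finite_set D -> D o -> 0 <= t ->
  kernel_max D t <= (nu o)^-1.
Proof.
move=> finD Do t0; rewrite /kernel_max big_seq; apply: bigmax_le.
  by rewrite invr_ge0 ltW// nu_gt0.
move=> x; rewrite in_fset_set// inE => Dx.
by rewrite heat_kernel_sym// heat_kernel_le.
Qed.

Lemma kernel_max_continuous D : finite_set D -> continuous (kernel_max D).
Proof.
move=> finD; apply: continuous_big => [p|x _ t].
  by apply: continuous_max; [exact: cvg_fst|exact: cvg_snd].
by apply: cvgM; [exact: semigroup_continuous|exact: cvg_cst].
Qed.

Definition kernel_potential D t : R := kernel_max D t `^ (q - 1).

Lemma kernel_potential_continuous D : finite_set D ->
  continuous (kernel_potential D).
Proof.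
move=> finD t; apply: cvg_powR_ge0 => //.
- by move=> s; exact: kernel_max_ge0.
- exact: kernel_max_ge0.
- exact: kernel_max_continuous.
Qed.

Lemma kernel_max_le_sup D t : finite_set D -> 0 <= t ->
  ((kernel_max D t)%:E <=
   ereal_sup [set (minimal_heat_kernel G sigma t o x)%:E | x in [set: V]])%E.
Proof.
move=> finD t0.
have ksup x : ((heat_kernel D t o x)%:E <=
    ereal_sup [set (minimal_heat_kernel G sigma t o x)%:E | x in [set: V]])%E.
  apply: (@le_trans _ _ (minimal_heat_kernel G sigma t o x)%:E).
    by rewrite lee_fin heat_kernel_le_minimal.
  by apply: ereal_sup_ubound; exists x.
rewrite /kernel_max; elim/big_ind: _ => [|x y xs ys|x _]; last exact: ksup.
  by apply: le_trans (ksup o); rewrite lee_fin heat_kernel_ge0.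
by rewrite EFin_max ge_max xs ys.
Qed.

(** Before time 1 the kernel is at most 1 / nu(o), by symmetry; after time 1 it
    is below the minimal kernel, and the hypothesis applies. The bound K does
    not depend on D. *)
Lemma kernel_potential_integral_le :
  (\int[lebesgue_measure]_(t in `[1%R, +oo[)
     (ereal_sup [set (minimal_heat_kernel G sigma t o x)%:E | x in [set: V]])
       `^ (q - 1)%R < +oo)%E ->
  exists2 K : R, 0 < K & forall D, finite_set D -> D o ->
    forall T, 0 <= T -> \int[leb]_(t in `[0, T]) kernel_potential D t <= K.
Proof.
set I := (\int[_]_(_ in _) _)%E => Ifin.
have I0 : (0 <= I)%E by apply: integral_ge0 => t _; exact: poweR_ge0.
have IE : I = (fine I)%:E by rewrite fineK// ge0_fin_numE.
pose B := (nu o)^-1 `^ (q - 1).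
have B0 : 0 < B by rewrite powR_gt0// invr_gt0 nu_gt0.
exists (B + fine I); first by rewrite ltr_pwDl// fine_ge0.
move=> D finD Do T T0.
have cm := kernel_potential_continuous finD.
have m0 t : 0 <= kernel_potential D t by exact: powR_ge0.
have iT := continuous_integrable_itv 0 T cm.
have mm (A : set (measurableTypeR R)) : measurable A ->
    measurable_fun A (EFin \o kernel_potential D).
  move=> mA; apply/measurable_EFinP; apply: measurable_funTS.
  exact: continuous_measurable_fun.
rewrite -lee_fin /Rintegral fineK; last exact: integrable_fin_num.
apply: (@le_trans _ _ (\int[leb]_(t in `[0%R, 1%R[ `|` `[1%R, +oo[)
    (kernel_potential D t)%:E)%E).
  apply: ge0_subset_integral => //.
  - exact: measurableU.
  - by apply: mm; exact: measurableU.
  - by move=> t _; rewrite lee_fin.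
  - move=> t /=; rewrite !in_itv/= => /andP[-> _].
    by rewrite andbT; have [] := ltP t 1; [left|right].
rewrite ge0_integral_setU//; last 3 first.
- by apply: mm; exact: measurableU.
- by move=> t _; rewrite lee_fin.
- apply/disj_set2P; rewrite -subset0 => t/=; rewrite !in_itv/= andbT.
  by move=> [/andP[_ t1]]; rewrite leNgt t1.
rewrite EFinD; apply: leeD.
  apply: (@le_trans _ _ (\int[leb]_(t in `[0%R, 1%R[) (cst B%:E) t)%E).
    apply: le_ge0_integral => t; first by rewrite lee_fin.
    rewrite /= in_itv/= => /andP[t0 _]; rewrite lee_fin /kernel_potential.
    rewrite ge0_ler_powR ?nnegrE ?kernel_max_ge0 ?kernel_max_le//.
    by rewrite invr_ge0 ltW// nu_gt0.
  rewrite integral_cst//= lebesgue_measure_itv/= lte_fin ltr01.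
  by rewrite -EFinB subr0 mule1.
rewrite -IE; apply: le_ge0_integral => t; first by rewrite lee_fin.
rewrite /= in_itv/= andbT => t1; have t0 : 0 <= t by exact: le_trans t1.
rewrite /kernel_potential -poweR_EFin; have msup := kernel_max_le_sup finD t0.
apply: gt0_ler_poweR => //; rewrite in_itv/= leey andbT.
  by rewrite lee_fin kernel_max_ge0.
by apply: le_trans msup; rewrite lee_fin kernel_max_ge0.
Qed.

(** The factor A = 1 + c * (integral of kernel_potential), written as a Duhamel
    formula with zero damping to inherit its continuity and derivative. *)
Definition amplification (c : R) D : R -> R :=
  duhamel 0 1 (fun s => c * kernel_potential D s).

Lemma amplification_bounds (c K : R) D t : finite_set D -> 0 <= c -> 0 <= t ->
  \int[leb]_(t in `[0, t]) kernel_potential D t <= K -> c * K <= 1 ->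
  1 <= amplification c D t <= 2.
Proof.
move=> finD c0 t0 mK cK.
rewrite /amplification /duhamel mul0r oppr0 expR0 mul1r.
under eq_Rintegral do rewrite mul0r expR0 mul1r.
rewrite RintegralZl//; last first.
  exact/continuous_integrable_itv/kernel_potential_continuous.
apply/andP; split.
  by rewrite lerDl mulr_ge0// Rintegral_ge0// => s _; exact: powR_ge0.
rewrite (_ : 2 = 1 + 1 :> R) // lerD2l; apply: le_trans cK.
by rewrite ler_wpM2l.
Qed.

(** The supersolution is a * A * v, with v the Dirichlet flow of the ball of
    radius n; c is chosen so that c * kernel_potential dominates
    2 ^ q * a ^ (q - 1) * v ^ (q - 1), where 2 ^ q accounts for A <= 2. *)
Lemma picard_bounded_by_supersolution (a K : R) n t x : 0 < a -> 0 <= t ->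
  (forall D, finite_set D -> D o ->
    forall T, 0 <= T -> \int[leb]_(t in `[0, T]) kernel_potential D t <= K) ->
  2 `^ q * a `^ (q - 1) * nu o `^ (q - 1) * K <= 1 ->
  picard G sigma q o a n t x <= 2 * a.
Proof.
move=> a0 t0 intK; set c := (X in X * K) => cK.
pose D := graph_ball G o n.
have finD : finite_set D by exact: graph_ball_finite.
have Do : D o by exact: graph_ball_center.
have c0 : 0 <= c by rewrite !mulr_ge0 ?powR_ge0.
pose m := kernel_potential D.
have cm : continuous (fun s => c * m s).
  apply: continuous_mul; first exact: cst_continuous.
  exact: kernel_potential_continuous.
pose v s y := semigroup D s \1_[set o] y.
have v0 s y : 0 <= s -> 0 <= v s y.
  by move=> s0; apply: semigroup_ge0 => // z; rewrite indicE.
have v1 s y : 0 <= s -> v s y <= 1.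
  by move=> s0; apply: semigroup_le_cst.
have vk s y : D y -> v s y = nu o * heat_kernel D s o y.
  move=> Dy; rewrite heat_kernel_sym// /dirichlet_heat_kernel -/(v s y).
  by rewrite mulrC divfK// gt_eqF// nu_gt0.
pose A := amplification c D.
have A12 s : 0 <= s -> 1 <= A s <= 2.
  by move=> s0; apply: (@amplification_bounds c K) => //; exact: intK.
pose w s y := a * (A s * v s y).
have : picard G sigma q o a n t x <= w t x.
  apply: (picard_le_supersolution sigma_gt0 q_gt1 a0 (D := D) (n := n)) => //.
  - move=> y Dy; apply: continuous_mul; first exact: cst_continuous.
    apply: continuous_mul; last exact: semigroup_continuous.
    by apply: duhamel_continuous => T; exact: continuous_integrable_itv.
  - move=> s y s0 Dy.
    have dv := semigroup_derive G sigma_gt0 s \1_[set o] finD Dy.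
    have dA := duhamel_derive 0 1 cm s0.
    exists (a * (c * m s * v s y + A s * laplacian (v s) y)).
      rewrite /w /A /amplification /v; apply: is_derive_eq.
      by rewrite -![_ *: _]/(_ * _); ring.
    rewrite /w laplacianZ laplacianZ.
    rewrite [leRHS]mulrDr addrC lerD2r.
    have [A1 A2] : 1 <= A s /\ A s <= 2 by apply/andP/A12/ltW.
    have vs0 := v0 s y (ltW s0).
    have A0 : 0 <= A s by exact: le_trans A1.
    have a_ge0 := ltW a0; have q0 : 0 < q by exact: lt_trans q_gt1.
    apply: (@le_trans _ _ ((2 * (a * v s y)) `^ q)).
      have av0 : 0 <= a * v s y by rewrite mulr_ge0.
      apply: ge0_ler_powR; rewrite ?nnegrE; [exact: ltW| | |].
      - by rewrite mulrCA mulr_ge0.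
      - by rewrite mulr_ge0.
      - by rewrite mulrCA ler_wpM2r.
    have -> : (2 * (a * v s y)) `^ q =
        2 `^ q * (a * a `^ (q - 1)) * v s y * v s y `^ (q - 1).
      rewrite !powRM ?mulr_ge0// -(mulr_powRB1 a_ge0 q0) -(mulr_powRB1 vs0 q0).
      by ring.
    have -> : a * (c * m s * v s y) =
        2 `^ q * (a * a `^ (q - 1)) * v s y * (nu o `^ (q - 1) * m s).
      by rewrite /c; ring.
    rewrite ler_wpM2l ?mulr_ge0 ?powR_ge0//.
    have nu0 : 0 <= nu o by rewrite ltW// nu_gt0.
    rewrite /m /kernel_potential -powRM ?kernel_max_ge0//.
    apply: ge0_ler_powR => //; rewrite ?nnegrE//.
      by rewrite mulr_ge0// kernel_max_ge0.
    by rewrite vk// ler_wpM2l// kernel_le_max.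
  - move=> y Dy; rewrite /w /A /amplification duhamel0 mul1r /v semigroup0.
    by rewrite zero_outside_in.
  - move=> s y s0; have /andP[A1 _] := A12 s s0.
    by rewrite mulr_ge0 ?(ltW a0)// mulr_ge0 ?(le_trans ler01 A1)// v0.
move=> /le_trans; apply; rewrite /w [leRHS]mulrC ler_wpM2l ?(ltW a0)//.
have /andP[A1 A2] := A12 t t0.
rewrite -[leRHS]mulr1; apply: ler_pM; rewrite ?v0 ?v1//.
exact: le_trans A1.
Qed.

End Supersolution.

Theorem proposition1p8 (R : realType) (V : choiceType)
  (G : weighted_graph R V) (sigma : V -> R) (rho : V -> V -> R)
  (sigma_gt0 : forall x, 0 < sigma x)
  (rho_length : edge_length G rho)
  (rho_adapted : adapted G sigma rho)
  (rho_proper : proper_metric (path_metric G rho))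
  (q : R) (q_gt1 : 1 < q) (o : V)
  (kernel_integral : (\int[lebesgue_measure]_(t in `[1%R, +oo[)
     (ereal_sup [set (minimal_heat_kernel G sigma t o x)%:E | x in [set: V]])
       `^ (q - 1)%R < +oo)%E) :
  exists a0 : R, 0 < a0 /\
    forall a : R, 0 < a -> a <= a0 ->
      exists u : R -> V -> R,
        positive_global_classical_solution G sigma q
          (fun x => a * \1_[set o] x) u.
Proof.
have [K K0 intK] :=
  kernel_potential_integral_le sigma_gt0 q_gt1 kernel_integral.
have q1 : 0 < q - 1 by rewrite subr_gt0.
(* With this B, a0 below is the solution of a0 ^ (q - 1) * B = 1. *)
pose B := 2 `^ q * nu G sigma o `^ (q - 1) * K.
have B0 : 0 < B by rewrite !mulr_gt0 ?powR_gt0// nu_gt0.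
exists (B^-1 `^ (q - 1)^-1); split; first by rewrite powR_gt0// invr_gt0.
move=> a a_gt0 aa0; exists (solution G sigma q o a).
apply: (solution_classical sigma_gt0 q_gt1 a_gt0 (C := 2 * a)) => n t x t0.
apply: (picard_bounded_by_supersolution sigma_gt0 q_gt1 n x a_gt0 t0 intK).
have : a `^ (q - 1) <= B^-1.
  apply: (@le_trans _ _ ((B^-1 `^ (q - 1)^-1) `^ (q - 1))).
    by rewrite ge0_ler_powR ?nnegrE ?powR_ge0// ltW.
  by rewrite -powRrM mulVf ?gt_eqF// powRr1// invr_ge0 ltW.
rewrite -(ler_pM2l B0) divff ?gt_eqF//; apply: le_trans.
by rewrite /B le_eqVlt; apply/orP; left; apply/eqP; ring.
Qed.
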